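(* Let $R$ be a commutative reduced ring. Then the following conditions are equivalent: (1) $R$ is von Neumann regular; (2) each semi-compact $R$-module is pure-injective.
   Context: Rings are associative with identity and modules are unitary. For an $R$-module $M$ and an ideal $I$, $M[I]=\{m\in M\mid Im=0\}$. $M$ is semi-compact if every set of congruences $x\equiv x_\alpha\pmod{M[I_\alpha]}$ ($\alpha\in\Lambda$, $x_\alpha\in M$, $I_\alpha$ an ideal of $R$), each finite subset of which has a common solution in $M$, has a simultaneous solution in $M$. A short exact sequence is pure if every finitely presented module is projective relative to it; a module is pure-injective if it is injective relative to every pure exact sequence. $R$ is von Neumann regular if for each $a\in R$ there is $b\in R$ with $a=aba$. *)

(* Defs.v *)
From HB Require Import structures.
From mathcomp Require Import all_boot all_order all_algebra.
From mathcomp Require Import boolp classical_sets functions cardinality.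

Set Implicit Arguments.
Unset Strict Implicit.
Unset Printing Implicit Defensive.

Import GRing.Theory.
Local Open Scope classical_set_scope.
Local Open Scope ring_scope.

(* Rings are [comPzRingType], so that the zero ring is not excluded. *)

Definition reduced (R : comPzRingType) : Prop :=
  forall (a : R) (n : nat), a ^+ n = 0 -> a = 0.

Definition von_neumann_regular (R : comPzRingType) : Prop :=
  forall a : R, exists b : R, a = a * b * a.

(* Unlike [idealr] of mathcomp's [ring_quotient], this allows the improper
   ideal: the congruences below include those modulo [M[R] = 0]. *)
Definition is_ideal (R : comPzRingType) (I : set R) : Prop :=
  [/\ I 0,
      forall a b : R, I a -> I b -> I (a + b) &
      forall r a : R, I a -> I (r * a)].

Section Modules.
Variable R : comPzRingType.

(* M[I] *)
Definition annihilated (M : lmodType R) (I : set R) : set M :=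
  [set m | forall r : R, I r -> r *: m = 0].

Definition semi_compact (M : lmodType R) : Prop :=
  forall (Lambda : Type) (c : Lambda -> M) (I : Lambda -> set R),
    (forall i, is_ideal (I i)) ->
    (forall F : set Lambda, finite_set F ->
       exists x : M, forall i, F i -> annihilated (I i) (x - c i)) ->
    exists x : M, forall i, annihilated (I i) (x - c i).

(* Exactness of U -> V -> W at V. *)
Definition exact_at (U V W : lmodType R)
    (f : {linear U -> V}) (g : {linear V -> W}) : Prop :=
  range f = [set v | g v = 0].

Definition short_exact (A B C : lmodType R)
    (f : {linear A -> B}) (g : {linear B -> C}) : Prop :=
  [/\ injective f, exact_at f g & range g = setT].

Definition finitely_presented (P : lmodType R) : Prop :=
  exists (m n : nat)
         (phi : {linear 'rV[R]_m -> 'rV[R]_n}) (psi : {linear 'rV[R]_n -> P}),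
    exact_at phi psi /\ range psi = setT.

Definition projective_relative (P B C : lmodType R)
    (g : {linear B -> C}) : Prop :=
  forall h : {linear P -> C}, exists k : {linear P -> B},
    forall p : P, g (k p) = h p.

Definition injective_relative (M A B : lmodType R)
    (f : {linear A -> B}) : Prop :=
  forall h : {linear A -> M}, exists k : {linear B -> M},
    forall a : A, k (f a) = h a.

Definition pure_exact (A B C : lmodType R)
    (f : {linear A -> B}) (g : {linear B -> C}) : Prop :=
  short_exact f g /\
  forall P : lmodType R, finitely_presented P -> projective_relative P g.

Definition pure_injective (M : lmodType R) : Prop :=
  forall (A B C : lmodType R) (f : {linear A -> B}) (g : {linear B -> C}),
    pure_exact f g -> injective_relative M f.

End Modules.

(* Main.v *)
Require Import Defs.
From HB Require Import structures.
From mathcomp Require Import all_boot all_order all_algebra.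
From mathcomp Require Import boolp classical_sets functions cardinality.
From mathcomp Require Import ring.

(** If [R] is von Neumann regular, a semi-compact module [M] is even injective.
    By Baer's criterion ([baer_criterion]) it is enough that each linear map
    [h] from an ideal [I] of [R] to [M] is multiplication by some [x : M].
    Every [r] in [I] is [r * b * r] for some [b], so [r *: x = h r] is the
    congruence [x = b *: h r] modulo [M[Rr]]. Finitely many elements
    of [I] are all fixed by one [e] in [I], and [h e] solves their congruences;
    semi-compactness then gives a simultaneous solution
    ([regular_semi_compact_baer]).

    Conversely, let [R] be reduced and let [a] have no [b] with [a = a * b * a].
    Then the multiplicative set [S] of the elements [a ^+ n * (1 - a * r)] does
    not contain [0], and an ideal [P] maximal among those that avoid [S] is
    prime. Let [D = R / P] and let [A] be the module of the finitely supported
    sequences in [D]. Modulo the prime [P], each [r : R] either kills [A] or acts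
    injectively on it, so each [A[I]] is [A] or [0] and [A] is semi-compact
    ([zero_or_injective_semi_compact]). But [A] is not pure-injective: it is a
    pure submodule of the module of all sequences ([finite_support_pure]), and
    a retraction would send the sequence [a ^+ i] to an element of [A] whose
    [n]-th entry is congruent to [a ^+ n] modulo [a ^+ n.+1] for each [n]. At
    an [n] where this entry is [0], some [a ^+ n * (1 + a * d)] vanishes in [D]
    ([retraction_kills_power]), that is, [P] meets [S]. *)

Set Implicit Arguments.
Unset Strict Implicit.
Unset Printing Implicit Defensive.

Import GRing.Theory.
Local Open Scope classical_set_scope.
Local Open Scope ring_scope.

(** * Submodules and quotient modules *)

Section SubmodulesAndQuotients.
Variables (R : comPzRingType) (V : lmodType R).

Definition submodule (U : set V) : Prop :=
  U 0 /\ forall (r : R) (u v : V), U u -> U v -> U (r *: u + v).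

Section SubmoduleTheory.
Variable U : set V.
Hypothesis hU : submodule U.

Lemma submodule0 : U 0. Proof. exact: hU.1. Qed.

Lemma submoduleZ r u : U u -> U (r *: u).
Proof. by move=> Uu; rewrite -[_ *: _]addr0; apply: hU.2 => //; apply: hU.1. Qed.

Lemma submoduleD u v : U u -> U v -> U (u + v).
Proof. by move=> Uu Uv; rewrite -[u]scale1r; apply: hU.2. Qed.

Lemma submoduleB u v : U u -> U v -> U (u - v).
Proof.
by move=> Uu Uv; apply: submoduleD => //; rewrite -scaleN1r; apply: submoduleZ.
Qed.

Lemma submodule_closed : submod_closed [pred v | `[< U v >]].
Proof.
split=> [|r u v /asboolP Uu /asboolP Uv]; apply/asboolP; first exact: submodule0.
exact: hU.2.
Qed.

Definition submod_pred : zmodClosed V :=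
  HB.pack_for (zmodClosed V) (fun v : V => `[< U v >])
    (GRing.isZmodClosed.Build V _ (GRing.submod_closedB submodule_closed)).

Definition quotmod := Quotient.quot submod_pred.

HB.instance Definition _ := GRing.Zmodule.on quotmod.

Local Notation pi := (\pi_(Quotient.quot submod_pred)%qT : V -> quotmod).

Lemma quotmod_piB (u v : V) : pi (u - v) = pi u - pi v.
Proof. exact: raddfB. Qed.

Lemma quotmod_piD (u v : V) : pi (u + v) = pi u + pi v.
Proof. exact: raddfD. Qed.

Lemma quotmod_pi_eq0 (v : V) : pi v = 0 <-> U v.
Proof.
have -> : 0 = pi 0 by rewrite -(subrr (0 : V)) quotmod_piB subrr.
rewrite -[v in U v]subr0; apply: (iff_trans (rwP eqP)).
by rewrite -Quotient.idealrBE; split => /asboolP.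
Qed.

Definition quotmod_scale (r : R) (q : quotmod) : quotmod := pi (r *: repr q).

(** Scaling is defined on a chosen representative; the result does not depend on
    it because [U] is stable under scaling. *)
Lemma quotmod_scaleE r v : quotmod_scale r (pi v) = pi (r *: v).
Proof.
apply/subr0_eq; rewrite -quotmod_piB -scalerBr; apply/quotmod_pi_eq0.
by apply: submoduleZ; apply/quotmod_pi_eq0; rewrite quotmod_piB reprK subrr.
Qed.

Lemma quotmod_piP (q : quotmod) : exists v, q = pi v.
Proof. by exists (repr q); rewrite reprK. Qed.

Lemma quotmod_scaleA a b q :
  quotmod_scale a (quotmod_scale b q) = quotmod_scale (a * b) q.
Proof. by have [v ->] := quotmod_piP q; rewrite !quotmod_scaleE scalerA. Qed.

Lemma quotmod_scale1 : left_id 1 quotmod_scale.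
Proof. by move=> q; have [v ->] := quotmod_piP q; rewrite quotmod_scaleE scale1r. Qed.

Lemma quotmod_scaleDr : right_distributive quotmod_scale +%R.
Proof.
move=> r p q; have [u ->] := quotmod_piP p; have [v ->] := quotmod_piP q.
by rewrite -quotmod_piD !quotmod_scaleE scalerDr quotmod_piD.
Qed.

Lemma quotmod_scaleDl q : {morph quotmod_scale^~ q : a b / a + b}.
Proof.
move=> a b; have [v ->] := quotmod_piP q.
by rewrite !quotmod_scaleE scalerDl quotmod_piD.
Qed.

HB.instance Definition _ := GRing.Zmodule_isLmodule.Build R quotmod
  quotmod_scaleA quotmod_scale1 quotmod_scaleDr quotmod_scaleDl.

Lemma exists_quotient :
  exists (C : lmodType R) (g : {linear V -> C}),
    range g = setT /\ forall v, g v = 0 <-> U v.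
Proof.
have pi_linear : linear pi by move=> r u v; rewrite quotmod_piD -quotmod_scaleE.
pose gL := GRing.isLinear.Build R V quotmod _ _ pi_linear.
exists (quotmod : lmodType R), (HB.pack_for {linear V -> quotmod} pi gL); split.
  by apply/seteqP; split=> // q _; have [v ->] := quotmod_piP q; exists v.
exact: quotmod_pi_eq0.
Qed.

Definition submod := {v : V | v \in submod_pred}.

HB.instance Definition _ := SubChoice.on submod.
HB.instance Definition _ := GRing.SubChoice_isSubLmodule.Build R V _ submod
  (GRing.submod_closed_semi submodule_closed).

Lemma exists_submodule :
  exists (A : lmodType R) (f : {linear A -> V}), injective f /\ range f = U.
Proof.
exists (submod : lmodType R), (val : {linear submod -> V}).
split; first exact: val_inj.
apply/seteqP; split=> [_ [x _ <-]|v Uv]; first exact/asboolP/(valP x).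
by exists (exist _ v (asboolT Uv)).
Qed.

End SubmoduleTheory.
End SubmodulesAndQuotients.

Lemma exists_linear (R : comPzRingType) (U V : lmodType R) (f : U -> V) :
  linear f -> exists k : {linear U -> V}, k =1 f.
Proof.
move=> hf; pose fL := GRing.isLinear.Build R U V _ f hf.
by exists (HB.pack_for {linear U -> V} f fL).
Qed.

(** The first isomorphism theorem, in the form needed to define maps out of a
    finitely presented module. *)
Lemma linear_factor (R : comPzRingType) (U V W : lmodType R)
    (p : {linear U -> V}) (f : {linear U -> W}) :
    range p = setT -> (forall u, p u = 0 -> f u = 0) ->
  exists k : {linear V -> W}, forall u, k (p u) = f u.
Proof.
move=> p_surj fp0.
have /choice[s sK] : forall v, exists u, p u = v.
  move=> v; have [u _ uv] : range p v by rewrite p_surj.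
  by exists u.
have fsE u v : p u = v -> f (s v) = f u.
  move=> puv; apply/subr0_eq; rewrite -linearB; apply: fp0.
  by rewrite linearB sK puv subrr.
have [|k kE] := @exists_linear R V W (f \o s).
  by move=> r u v /=; rewrite (fsE (r *: s u + s v)) linearP ?sK.
by exists k => u; rewrite kE /= (fsE u).
Qed.

(** Free modules are projective: it suffices to lift the images of the basis. *)
Lemma free_lift (R : comPzRingType) (n : nat) (B C : lmodType R)
    (g : {linear B -> C}) (h : {linear 'rV[R]_n -> C}) :
  range g = setT -> exists k : {linear 'rV[R]_n -> B}, forall v, g (k v) = h v.
Proof.
move=> g_surj.
have /choice[b bE] : forall j, exists b, g b = h (delta_mx 0 j).
  move=> j; have [b _ bj] : range g (h (delta_mx 0 j)) by rewrite g_surj.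
  by exists b.
have [|k kE] := @exists_linear R 'rV[R]_n B (fun v => \sum_j v 0 j *: b j).
  move=> r u v; rewrite scaler_sumr -big_split; apply: eq_bigr => j _ /=.
  by rewrite !mxE scalerDl scalerA.
exists k => v; rewrite kE linear_sum [in RHS](row_sum_delta v) linear_sum.
by apply: eq_bigr => j _; rewrite !linearZ /= bE.
Qed.

(** The single use of Zorn's lemma. Maximality is phrased as follows: enlarging [U]
    by any outside [x] makes it meet [S]. With [S] multiplicative this yields
    prime ideals; with [S] the nonzero vectors over [0] in a product module,
    maximal graphs of partial linear maps. *)
Lemma exists_maximal_avoiding (R : comPzRingType) (V : lmodType R)
    (U0 S : set V) :
    submodule U0 -> (forall v, U0 v -> ~ S v) ->
  exists U : set V, [/\ submodule U, U0 `<=` U, forall v, U v -> ~ S v &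
    forall x, ~ U x -> exists r u, U u /\ S (u + r *: x)].
Proof.
move=> U0sub U0S.
(* Adjoining [U0] to [X] makes the union of the empty chain admissible. *)
pose P := [set X | submodule (U0 `|` X) /\ forall v, (U0 `|` X) v -> ~ S v].
have [|A [[Asub AS] Amax]] := @Zorn_bigcup V P.
  move=> F FP Ftot; split; last first.
    move=> v [/U0S//|[X FX Xv]]; by apply: (FP X FX).2; right.
  split=> [|r u v]; first by left; exact: submodule0.
  have sub X : F X -> U0 `|` X `<=` U0 `|` \bigcup_(X in F) X.
    by move=> FX w [U0w|Xw]; [left|right; exists X].
  case=> [U0u|[X FX Xu]] [U0v|[Y FY Yv]].
  - by left; exact: U0sub.2.
  - by apply: (sub Y FY); apply: (FP Y FY).1.2; [left|right].
  - by apply: (sub X FX); apply: (FP X FX).1.2; [right|left].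
  - case: (Ftot X Y FX FY) => XY.
    + by apply: (sub Y FY); apply: (FP Y FY).1.2; right=> //; exact: XY.
    + by apply: (sub X FX); apply: (FP X FX).1.2; right=> //; exact: XY.
exists (U0 `|` A); split=> // x nUx.
apply: contrapT => nex.
pose W := [set w | exists r u, (U0 `|` A) u /\ w = u + r *: x].
have UW : U0 `|` A `<=` W by move=> u Uu; exists 0, u; rewrite scale0r addr0.
have WE : U0 `|` W = W by apply/setUidPr => u U0u; apply: UW; left.
have Wx : W x by exists 1, 0; rewrite scale1r add0r; split=> //; exact: submodule0.
apply: (Amax W).
  split; last by move=> /(_ x Wx) Ax; apply: nUx; right.
  by move=> v Av; apply: UW; right.
rewrite /P /mkset WE; split; last first.
  by move=> v [r [u [Uu ->]]] Sv; apply: nex; exists r, u.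
split; first by apply: UW; exact: submodule0.
move=> r _ _ [a [u [Uu ->]]] [b [v [Uv ->]]].
exists (r * a + b), (r *: u + v); split; first exact: Asub.2.
by rewrite scalerDl scalerDr scalerA addrACA.
Qed.

(** * Semi-compact modules over a regular ring are injective *)

(** A linear map from an ideal of [R] to [M] is given by its graph [H]; the second
    hypothesis on [H] says that it is single-valued. *)
Definition extends_from_ideals (R : comPzRingType) (M : lmodType R) : Prop :=
  forall H : set (R^o * M), submodule H -> (forall m, H (0, m) -> m = 0) ->
  exists x : M, forall r m, H (r, m) -> m = r *: x.

(** Take a maximal graph [G] in [B * M] that contains the map to be extended and
    remains single-valued. For [b : B], the pairs [(r, m)] with [(r *: b, m)] in
    [G] form the graph of a map on an ideal, which is multiplication by some [x];
    [(b, x)] can be adjoined to [G], so by maximality [b] is in the domain. *)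
Lemma baer_criterion (R : comPzRingType) (M A B : lmodType R)
    (f : {linear A -> B}) :
  extends_from_ideals M -> injective f -> injective_relative M f.
Proof.
move=> baerM f_inj h.
have [||G [Gsub G0G GS Gmax]] := @exists_maximal_avoiding R (B * M)%type
    (range (fun a => (f a, h a))) [set p | p.1 = 0 /\ p.2 <> 0].
- split; first by exists 0; rewrite ?linear0.
  by move=> r _ _ [a _ <-] [b _ <-]; exists (r *: a + b); rewrite ?linearP.
- by move=> _ [a _ <-] /= [+ []]; rewrite -(linear0 f) => /f_inj ->; rewrite linear0.
have Gfun b m m' : G (b, m) -> G (b, m') -> m = m'.
  move=> Gm Gm'; apply/subr0_eq; apply: contrapT => mm'.
  apply: (GS _ (submoduleB Gsub Gm Gm')); split=> //=; exact: subrr.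
have /choice[k Gk] : forall b, exists m, G (b, m).
  move=> b; have [|m mP|x xP] := baerM [set p | G (p.1 *: b, p.2)].
  - split=> [|r [s m] [t n] /= Gs Gt]; first by rewrite /= scale0r; exact: Gsub.1.
    rewrite scalerDl -scalerA; exact: (Gsub.2 r _ _ Gs Gt).
  - by move: mP; rewrite /= scale0r => /Gfun; apply; exact: Gsub.1.
  exists x; apply: contrapT => /Gmax[r [[c n] [Gcn [/= cb nx]]]]; apply: nx.
  have /xP -> : G ((- r) *: b, n) by rewrite scaleNr -(addr0_eq cb) opprK.
  by rewrite scaleNr addNr.
have [|kL kLE] := @exists_linear R B M k.
  by move=> r u v; apply: Gfun (Gk _) _; exact: (Gsub.2 r _ _ (Gk u) (Gk v)).
by exists kL => a; rewrite kLE; apply: Gfun (Gk _) _; apply: G0G; exists a.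
Qed.

Lemma principal_is_ideal (R : comPzRingType) (a : R) :
  is_ideal [set s * a | s in setT].
Proof.
split=> [|_ _ [s _ <-] [t _ <-]|r _ [s _ <-]].
- by exists 0; rewrite ?mul0r.
- by exists (s + t); rewrite ?mulrDl.
- by exists (r * s); rewrite ?mulrA.
Qed.

(** The value [m] at [r] forces [r *: x = m]. As [r = r * b * r], the element
    [b *: m] satisfies this, and the equation says that [x] agrees with it modulo
    the annihilator in [M] of the principal ideal of [r]. *)
Lemma regular_semi_compact_baer (R : comPzRingType) (M : lmodType R) :
  von_neumann_regular R -> semi_compact M -> extends_from_ideals M.
Proof.
move=> /choice[b abE] scM H Hsub Hfun0.
have Hfun r m m' : H (r, m) -> H (r, m') -> m = m'.
  move=> Hm Hm'; apply/subr0_eq; apply: Hfun0.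
  by have := submoduleB Hsub Hm Hm'; congr (H (_, _)); exact: subrr.
have Hfix (r : R) m : H (r, m) -> r *: (b r *: m) = m.
  move=> Hrm; apply: (Hfun r) => //; rewrite scalerA.
  have := submoduleZ Hsub (r * b r) Hrm; congr (H (_, _)).
  exact: esym (abE r).
have Hsolve (r : R) m n (f : R) : r * f = r -> H (r, m) -> H (f, n) -> m = r *: n.
  move=> rf Hrm /(submoduleZ Hsub r) Hfn; apply: (Hfun r) => //.
  by move: Hfn; congr (H (_, _)).
(* Finitely many elements of the ideal have a common unit [f] inside it: to
   include [r], replace [f] by [f + e - f * e], where [e = b r * r]. *)
have join (s : seq (R^o * M)) : (forall p, p \in s -> H p) ->
    exists f n, H (f, n) /\ forall p, p \in s -> p.1 * f = p.1 :> R.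
  elim: s => [|[r m] s IHs] sH.
    by exists 0, 0; split=> //; exact: Hsub.1.
  have [|f [n [Hfn sf]]] := IHs.
    by move=> p ps; apply: sH; rewrite inE ps orbT.
  have Hrm : H (r, m) by apply: sH; rewrite inE eqxx.
  exists (f + b r * (r : R) - f * (b r * (r : R))).
  exists (n + b r *: m - f *: (b r *: m)); split.
    have Hbr := submoduleZ Hsub (b r) Hrm.
    exact: submoduleB (submoduleD Hsub Hfn Hbr) (submoduleZ Hsub f Hbr).
  move=> [r' m']; rewrite inE => /orP[/eqP[-> _]|/sf /= r'f] /=.
    have rbr : (r : R) * (b r * (r : R)) = r by rewrite mulrA -abE.
    by rewrite mulrBr mulrDr (mulrCA r f) rbr [f * _]mulrC addrAC subrr add0r.
  by rewrite mulrBr mulrDr [_ * (f * _)]mulrA r'f addrK.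
pose L := {p : R^o * M | H p}.
have [||x xP] := scM L (fun p => b (sval p).1 *: (sval p).2)
    (fun p => [set s * ((sval p).1 : R) | s in setT]).
- by move=> p; exact: principal_is_ideal.
- move=> F Ffin; have /finite_seqP[s sE] := finite_image (fun p : L => sval p) Ffin.
  have [p ps|f [n [Hfn sf]]] := join s.
    have : [set sval q | q in F] p by rewrite sE.
    by case=> q _ <-; exact: svalP.
  exists n => [[[r m] Hrm]] FHr _ [t _ <-] /=.
  rewrite -scalerA scalerBr Hfix // -(Hsolve r m n f) ?subrr ?scaler0 //.
  apply: (sf (r, m)); have : [set sval q | q in F] (r, m).
    by exists (exist _ (r, m) Hrm).
  by rewrite sE.
- exists x => r m Hrm.
  have := xP (exist _ (r, m) Hrm) (r : R); rewrite /= scalerBr Hfix // => rx.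
  by apply/esym/subr0_eq; apply: rx; exists 1; rewrite ?mul1r.
Qed.

(** * A semi-compact module that is not pure-injective *)

(** Each [M[I]] is [M] or [0]. A congruence modulo [M] holds for every [x], and one
    modulo [0] determines [x]; so if there is one of the latter kind, its solution
    is the only candidate, and solvability of pairs shows that it works. *)
Lemma zero_or_injective_semi_compact (R : comPzRingType) (M : lmodType R) :
    (forall r : R, (forall m : M, r *: m = 0) \/
                   (forall m : M, r *: m = 0 -> m = 0)) ->
  semi_compact M.
Proof.
move=> dichotomy L c I _ fin_solvable.
have [[i0 [r0 [Ir0 r0inj]]]|none] := pselect (exists i0 (r : R), I i0 r /\
    forall m : M, r *: m = 0 -> m = 0).
  exists (c i0) => i.
  have [y yP] := fin_solvable [set i0; i] (finite_set2 i0 i).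
  have /subr0_eq <- : y - c i0 = 0.
    by apply/r0inj; apply: (yP i0) => //; left.
  by apply: yP; right.
exists 0 => i r Ir; case: (dichotomy r) => // rinj.
by case: none; exists i, r.
Qed.

Section FiniteSupport.
Variables (R : comPzRingType) (D : lmodType R).

Definition finite_support : set (nat -> D) :=
  [set b | exists N, forall i, (N <= i)%N -> b i = 0].

Lemma finite_support_submodule : submodule finite_support.
Proof.
split=> [|r u v [m um] [n vn]]; first by exists 0.
exists (maxn m n) => i; rewrite geq_max => /andP[mi ni].
by rewrite -[LHS]/(r *: u i + v i) um // vn // scaler0 addr0.
Qed.

Definition tail (N : nat) (b : nat -> D) : nat -> D :=
  fun i => if (i < N)%N then 0 else b i.

Lemma tail_linear N : linear (tail N).
Proof.
move=> r u v; apply/funext => i.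
rewrite -[RHS]/(r *: tail N u i + tail N v i) /tail.
by case: ifP => // _; rewrite scaler0 addr0.
Qed.

Lemma sub_tail_finite_support N b : finite_support (b - tail N b).
Proof. by exists N => i Ni; rewrite -[LHS]/(b i - tail N b i) /tail ltnNge Ni subrr. Qed.

(** Finitely many finitely supported sequences vanish beyond a common place; this
    is what makes [finite_support] pure in the module of all sequences. *)
Lemma finite_support_common_bound n (b : 'I_n -> nat -> D) :
  (forall j, finite_support (b j)) -> exists N, forall j, tail N (b j) = 0.
Proof.
move=> /choice[N NP]; exists (\max_j N j) => j; apply/funext => i; rewrite /tail.
case: ltnP => // ji; apply: (NP j); apply: leq_trans ji; exact: leq_bigmax.
Qed.

(** Lift a map on a finitely presented module to sequences on the generators. The
    finitely many relations are sent to finitely supported sequences, so they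
    become [0] when the lifts are replaced by their tails, which does not change
    them modulo [finite_support]. *)
Lemma finite_support_pure (A C : lmodType R) (f : {linear A -> (nat -> D)})
    (g : {linear (nat -> D) -> C}) :
    injective f -> range f = finite_support -> range g = setT ->
    (forall b, g b = 0 <-> finite_support b) ->
  pure_exact f g.
Proof.
move=> f_inj f_range g_surj g_ker; split.
  split=> //; rewrite /exact_at f_range.
  by apply/seteqP; split=> b /g_ker.
move=> P [m [n [phi [psi [phi_psi psi_surj]]]]] h.
have [beta betaE] := free_lift (h \o psi)%FUN g_surj.
have [N NP] : exists N, forall j : 'I_m, tail N (beta (phi (delta_mx 0 j))) = 0.
  apply: finite_support_common_bound => j; apply/g_ker; rewrite betaE /=.
  have -> : psi (phi (delta_mx 0 j)) = 0.
    suff : [set v | psi v = 0] (phi (delta_mx 0 j)) by [].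
    by rewrite -phi_psi; exists (delta_mx 0 j).
  exact: linear0.
have [tl tlE] := exists_linear (tail_linear N).
have [|k kE] := @linear_factor R _ _ _ psi (tl \o beta)%FUN psi_surj.
  move=> v psiv; have [w _ <-] : range phi v by rewrite phi_psi.
  rewrite (row_sum_delta w) !linear_sum big1 // => j _.
  by rewrite !linearZ /= tlE NP scaler0.
exists k => p; have [v _ <-] : range psi p by rewrite psi_surj.
rewrite kE /= tlE; apply/subr0_eq.
rewrite -[h _](betaE v) -linearB; apply/g_ker.
rewrite -opprB -scaleN1r; apply: submoduleZ; first exact: finite_support_submodule.
exact: sub_tail_finite_support.
Qed.

(** The part of the sequence [a ^+ i *: u] beyond any place is divisible by the
    corresponding power of [a] in the module of all sequences. *)
Lemma geometric_sequence_tail (a : R) (u : D) n :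
  exists t y : nat -> D, [/\ finite_support t,
    (fun i => a ^+ i *: u) = t + a ^+ n.+1 *: y &
    t n = a ^+ n *: u].
Proof.
pose b : nat -> D := fun i => a ^+ i *: u.
pose y i := if (i < n.+1)%N then 0 else a ^+ (i - n.+1) *: u.
exists (b - tail n.+1 b), y.
split; first exact: sub_tail_finite_support.
  apply/funext => i.
  rewrite -[RHS]/(b i - tail n.+1 b i + a ^+ n.+1 *: y i) /tail /y.
  case: ltnP => ni; first by rewrite subr0 scaler0 addr0.
  by rewrite subrr add0r scalerA -exprD subnKC.
by rewrite -[LHS]/(b n - tail n.+1 b n) /tail ltnSn subr0.
Qed.

End FiniteSupport.

(** If neither [x] nor [y] is in [P], then both [P + R x] and [P + R y] meet [S];
    the product of the two elements is in [S] and, if [x * y] is in [P], in [P]. *)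
Lemma avoiding_ideal_prime (R : comPzRingType) (P S : set R^o) :
    submodule P -> (forall r, P r -> ~ S r) ->
    (forall x, ~ P x -> exists r u, P u /\ S (u + r *: x)) ->
    (forall s t : R, S s -> S t -> S (s * t)) ->
  forall x y : R, P (x * y) -> ~ P x -> P y.
Proof.
move=> Psub PS Pmax SM x y Pxy /Pmax[r [u [Pu Sx]]]; apply: contrapT.
move=> /Pmax[s [v [Pv Sy]]]; apply: (PS _ _ (SM _ _ Sx Sy)).
have -> : (u + r * x) * (v + s * y) =
    (v + s * y) * u + (r * x * v + (r * s) * (x * y)).
  ring.
apply: Psub.2 => //; apply: Psub.2 => //; exact: (submoduleZ Psub).
Qed.

(** Let [k] be a retraction and [n] a place where the image of the sequence
    [a ^+ i *: u] is [0]. That sequence is a finitely supported one, fixed by [k],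
    plus [a ^+ n.+1] times another; compare the entries at [n]. *)
Lemma retraction_kills_power (R : comPzRingType) (D A : lmodType R)
    (f : {linear A -> (nat -> D)}) (k : {linear (nat -> D) -> A}) (a : R) (u : D) :
    range f = @finite_support R D -> (forall x, k (f x) = x) ->
  exists n d, a ^+ n *: (u + a *: d) = 0.
Proof.
move=> f_range kf; pose b : nat -> D := fun i => a ^+ i *: u.
have [n nP] : finite_support (f (k b)) by rewrite -f_range; exists (k b).
have [t [y [tfin bE tn]]] := geometric_sequence_tail a u n.
have [x _ xt] : range f t by rewrite f_range.
exists n, (f (k y) n); rewrite scalerDr scalerA -exprSr -tn -(nP n) //.
by rewrite /b bE -xt linearD kf linearZ /= linearD linearZ.
Qed.

Lemma pure_injective_regular (R : comPzRingType) :
    reduced R -> (forall M : lmodType R, semi_compact M -> pure_injective M) ->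
  von_neumann_regular R.
Proof.
move=> redR scpi a; apply: contrapT => a_irr.
pose S : set R^o := [set s | exists n r, s = a ^+ n * (1 - a * r)].
(* If [a ^+ n * (1 - a * r) = 0], then [a - a * r * a] is nilpotent. *)
have S0 : ~ S 0.
  case=> n [r /esym a0]; apply: a_irr; exists r.
  apply/subr0_eq; have -> : a - a * r * a = a * (1 - a * r).
    by rewrite mulrBr mulr1 mulrA mulrAC.
  apply: (redR _ n.+1).
  by rewrite exprMn exprSr [X in _ * X]exprS mulrACA a0 mul0r.
have SM (s t : R) : S s -> S t -> S (s * t).
  move=> [m [r ->]] [n [q ->]]; exists (m + n)%N, (r + q - a * r * q).
  rewrite mulrACA -exprD; congr (_ * _).
  ring.
have [||P [Psub _ PS Pmax]] := @exists_maximal_avoiding R R^o [set 0] S.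
- by split=> // r u v -> ->; rewrite scaler0 addr0.
- by move=> v ->.
have Pprime := avoiding_ideal_prime Psub PS Pmax SM.
have [D [pi [pi_surj pi_ker]]] := exists_quotient Psub.
have piZ r s : r *: pi s = pi (r * s) by rewrite -linearZ.
have [A [f [f_inj f_range]]] := exists_submodule (@finite_support_submodule R D).
have [C [g [g_surj g_ker]]] := exists_quotient (@finite_support_submodule R D).
have f_pure := finite_support_pure f_inj f_range g_surj g_ker.
have A_sc : semi_compact A.
  apply: zero_or_injective_semi_compact => r; have [Pr|nPr] := pselect (P r).
    left=> m; apply: f_inj; rewrite linearZ linear0; apply/funext => i.
    have [s _ sE] : range pi (f m i) by rewrite pi_surj.
    rewrite -[LHS]/(r *: f m i) -sE piZ; apply/pi_ker; rewrite mulrC.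
    exact: (submoduleZ Psub s Pr).
  right=> m rm0; apply: f_inj; rewrite linear0; apply/funext => i.
  have : r *: f m i = 0 by rewrite -[LHS]/((r *: f m) i) -linearZ rm0 linear0.
  have [s _ <-] : range pi (f m i) by rewrite pi_surj.
  by rewrite piZ => /pi_ker Prs; apply/pi_ker; exact: (Pprime r).
(* Extending the identity of [A] along [f] gives the retraction. *)
have [k kf] := scpi A A_sc _ _ _ f g f_pure idfun.
have [n [d]] := retraction_kills_power a (pi 1) f_range kf.
have [s _ <-] : range pi d by rewrite pi_surj.
rewrite piZ -linearD piZ => /pi_ker /PS; apply.
by exists n, (- s); rewrite mulrN opprK.
Qed.

Theorem theorem4p2 (R : comPzRingType) (hR : reduced R) :
  von_neumann_regular R <->
  (forall M : lmodType R, semi_compact M -> pure_injective M).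
Proof.
split=> [regR M scM A B C f g [[f_inj _ _] _]|].
  exact: baer_criterion (regular_semi_compact_baer regR scM) f_inj.
exact: pure_injective_regular.
Qed.
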